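(* Let $\sigma\in[1,\infty)$ and $x_k=y_k=k+\sigma-1$, $k\ge1$ (the shifted Plancherel specialization). For each $n$ let $\boldsymbol\sigma\in\mathfrak S_n$ (bold, not to be confused with the real parameter $\sigma$) be a random involution distributed according to $\nu_n(\cdot\mid\varphi_{\vec x,\vec y},\varphi_{\mathrm{PL}})$, and let $G_n(\sigma)=\mathbb E_{\nu_n}[\#\,\text{two-cycles}(\boldsymbol\sigma)]$. Then $$\lim_{n\to\infty}\frac{G_n(\sigma)}{n}=\frac1{\sigma+1}.$$
   Context: A Fibonacci word is a finite (possibly empty) word in the letters $1,2$; $|w|$ is the sum of its letters; $\mathbb{YF}_n$ is the set of words of weight $n$. $\dim(\varnothing)=1$, $\dim(1v)=\dim(v)$, $\dim(2v)=(|v|+1)\dim(v)$. For sequences $\vec x,\vec y$: $A_\ell$ ($A_0=1$) is the determinant of the $\ell\times\ell$ tridiagonal matrix with diagonal $x_1,\ldots,x_\ell$, superdiagonal $y_1,\ldots,y_{\ell-1}$ and subdiagonal entries $1$; $B_k(m)$ is the determinant of the $(k+1)\times(k+1)$ tridiagonal matrix with diagonal $y_{m+1},x_{m+3},\ldots,x_{m+k+2}$, superdiagonal $x_{m+1}y_{m+2},y_{m+3},\ldots,y_{m+k+1}$, subdiagonal entries $1$. Clone Schur functions: $s_{1^k}=A_k$, $s_{1^k2u}=B_k(|u|)\,s_u$. The clone harmonic function is $\varphi_{\vec x,\vec y}(w)=s_w(\vec x\mid\vec y)/(x_1\cdots x_{|w|})$. Young–Fibonacci Robinson–Schensted shape: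 for a permutation $\boldsymbol\sigma=(\boldsymbol\sigma_1,\ldots,\boldsymbol\sigma_n)$ in one-line notation, process the entries from right to left; each not yet matched entry $\boldsymbol\sigma_k$ is matched with the maximal unmatched entry among those in positions $\le k$ (possibly with itself). Record a letter $1$ if $\boldsymbol\sigma_k$ is matched with itself and a letter $2$ otherwise; the recorded letters, written left to right in the order produced, form the shape $w(\boldsymbol\sigma)\in\mathbb{YF}_n$. For an involution, the letters $2$ of $w(\boldsymbol\sigma)$ correspond to its two-cycles, and the number of involutions with shape $w$ is $\dim(w)$. The measure $\nu_n(\cdot\mid\varphi_{\vec x,\vec y},\varphi_{\mathrm{PL}})$ on involutions in $\mathfrak S_n$: choose $w\in\mathbb{YF}_n$ with probability $\dim(w)\varphi_{\vec x,\vec y}(w)$, then an involution uniformly among the $\dim(w)$ involutions of shape $w$; equivalently $\nu_n(\boldsymbol\sigma)=\varphi_{\vec x,\vec y}(w(\boldsymbol\sigma))$. Thus $G_n(\sigma)$ is also the expected number of letters $2$ in a random word $w\in\mathbb{YF}_n$ with probability weights $\dim(w)\varphi_{\vec x,\vec y}(w)$. *)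

(* Defs.v *)
From mathcomp Require Import all_boot all_order all_fingroup all_algebra.
From mathcomp Require Import all_classical all_reals all_analysis.

Set Implicit Arguments.
Unset Strict Implicit.
Unset Printing Implicit Defensive.

Import Order.TTheory GRing.Theory Num.Theory.

Inductive letter := F1 | F2.

Definition fibword := seq letter.

Fixpoint weight (w : fibword) : nat :=
  match w with
  | [::] => 0
  | F1 :: v => (weight v).+1
  | F2 :: v => (weight v).+2
  end.

Fixpoint yfdim (w : fibword) : nat :=
  match w with
  | [::] => 1
  | F1 :: v => yfdim v
  | F2 :: v => (weight v).+1 * yfdim v
  end.

Local Open Scope ring_scope.

(* Sequences x, y : nat -> R are indexed from 1; the values at 0 are never
   used. Matrix rows and columns are indexed from 0. *)

Definition tridiag (R : comNzRingType) (l : nat) (diag sup : nat -> R) :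
    'M[R]_l :=
  \matrix_(i < l, j < l)
    if j == i :> nat then diag i
    else if j == i.+1 :> nat then sup i
    else if i == j.+1 :> nat then 1
    else 0.

Definition cloneA (R : comNzRingType) (x y : nat -> R) (l : nat) : R :=
  \det (tridiag l (fun i => x i.+1) (fun i => y i.+1)).

Definition cloneB (R : comNzRingType) (x y : nat -> R) (k m : nat) : R :=
  \det (tridiag k.+1
    (fun i => if i == 0%N then y m.+1 else x (m + i + 2)%N)
    (fun i => if i == 0%N then x m.+1 * y m.+2 else y (m + i + 2)%N)).

(* [clone_schur_rec x y k w] is the clone Schur function of the word 1^k w. *)
Fixpoint clone_schur_rec (R : comNzRingType) (x y : nat -> R) (k : nat)
    (w : fibword) : R :=
  match w with
  | [::] => cloneA x y k
  | F1 :: v => clone_schur_rec x y k.+1 v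
  | F2 :: u => cloneB x y k (weight u) * clone_schur_rec x y 0 u
  end.

Definition clone_schur (R : comNzRingType) (x y : nat -> R) (w : fibword) : R :=
  clone_schur_rec x y 0 w.

Definition clone_harmonic (R : fieldType) (x y : nat -> R) (w : fibword) : R :=
  clone_schur x y w / \prod_(1 <= i < (weight w).+1) x i.

(* [t] lists the entries that remain to be processed, rightmost first, and
   [matched] the entries already matched with an entry to their right. *)
Fixpoint yfrs_rec (matched t : seq nat) : fibword :=
  match t with
  | [::] => [::]
  | a :: t' =>
      if a \in matched then yfrs_rec matched t'
      else
        let b := (\max_(c <- a :: t' | c \notin matched) c)%N in
        if b == a then F1 :: yfrs_rec matched t'
        else F2 :: yfrs_rec (b :: matched) t'
  end.

Definition oneline (n : nat) (s : 'S_n) : seq nat :=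
  [seq val (s i) | i <- enum 'I_n].

Definition yfrs_shape (n : nat) (s : 'S_n) : fibword :=
  yfrs_rec [::] (rev (oneline s)).

Definition involution (n : nat) (s : 'S_n) : bool := (s * s == 1)%g.

Definition two_cycles (n : nat) (s : 'S_n) : nat :=
  #|[set c in porbits s | #|c| == 2%N]|.

Definition same_shape_involutions (n : nat) (s : 'S_n) : {set 'S_n} :=
  [set t : 'S_n | involution t & `[< yfrs_shape t = yfrs_shape s >]].

(* The shape w is chosen with probability dim(w) phi(w), then an involution
   uniformly among those of shape w. *)
Definition nu (R : fieldType) (x y : nat -> R) (n : nat) (s : 'S_n) : R :=
  if involution s then
    (yfdim (yfrs_shape s))%:R * clone_harmonic x y (yfrs_shape s)
      / #|same_shape_involutions s|%:R
  else 0.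

Definition shifted_plancherel (R : nzRingType) (sigma : R) (k : nat) : R :=
  k%:R + sigma - 1.

Definition expected_two_cycles (R : fieldType) (sigma : R) (n : nat) : R :=
  \sum_(s : 'S_n)
    nu (shifted_plancherel sigma) (shifted_plancherel sigma) s
      * (two_cycles s)%:R.

(* Main.v *)
(* For an involution, each step of the Robinson-Schensted procedure matches the
   entry at position k with the value k, so the letters 2 of the shape count the
   two-cycles, and every word is a shape (swap adjacent points).  Hence G_n is the
   mean number of letters 2 in a random word.  In the shifted Plancherel
   specialization B_k(m) = x_(m+1) does not depend on k; splitting off the first
   letter of the word gives
     (n + 1 + sigma) G_(n+2) = G_(n+1) + (n + 1) (1 + G_n).
   The line n / (sigma + 1) solves this recurrence up to a bounded error, and the
   deviation of G_n from it is at most the n-th harmonic number, which is o(n). *)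
Require Import Defs.
From HB Require Import structures.
From mathcomp Require Import all_boot all_order all_fingroup all_algebra.
From mathcomp Require Import all_classical all_reals all_analysis.
From mathcomp Require Import zify ring lra.
Import Order.TTheory GRing.Theory Num.Theory.
Import numFieldNormedType.Exports.
Set Implicit Arguments.
Unset Strict Implicit.
Unset Printing Implicit Defensive.
Local Open Scope classical_set_scope.
Local Open Scope ring_scope.

(** * Tridiagonal determinants and the clone coefficients A and B *)

Lemma det_tridiagSS_first (R : comNzRingType) (l : nat) (d s : nat -> R) :
  \det (tridiag l.+2 d s) =
    d 0%N * \det (tridiag l.+1 (fun i => d i.+1) (fun i => s i.+1))
    - s 0%N * \det (tridiag l (fun i => d i.+2) (fun i => s i.+2)).
Proof.
rewrite (expand_det_row _ ord0) !big_ord_recl big1 ?addr0; last first.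
  by move=> i _; rewrite mxE /= mul0r.
rewrite !mxE /= /cofactor /= expr0 mul1r expr1 mulN1r mulrN.
congr (_ * \det _ - _ * _).
  by apply/matrixP => i j; rewrite !mxE /= /bump /= ?add1n ?eqSS.
rewrite (expand_det_col _ ord0) big_ord_recl big1 ?addr0; last first.
  by move=> i _; rewrite !mxE /= mul0r.
rewrite !mxE /= mul1r /cofactor expr0 mul1r; congr (\det _).
by apply/matrixP => i j; rewrite !mxE /= /bump /= ?add1n /= ?add1n ?eqSS.
Qed.

Lemma det_tridiag0 (R : comNzRingType) (d s : nat -> R) :
  \det (tridiag 0 d s) = (1 : R).
Proof. exact: det_mx00. Qed.

Lemma det_tridiag1 (R : comNzRingType) (d s : nat -> R) :
  \det (tridiag 1 d s) = d 0%N.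
Proof. by rewrite det_mx11 mxE. Qed.

(** Expanding at the top corner, applying induction to both shorter determinants and folding the top
    expansions back moves the recurrence to the bottom corner. That form suits [cloneA] and
    [cloneB], where a longer determinant only appends a row and a column. *)
Lemma det_tridiagSS (R : comNzRingType) (l : nat) (d s : nat -> R) :
  \det (tridiag l.+2 d s) =
    d l.+1 * \det (tridiag l.+1 d s) - s l * \det (tridiag l d s).
Proof.
elim/ltn_ind: l d s => -[|[|l]] IH d s.
- by rewrite det_tridiagSS_first !det_tridiag1 !det_tridiag0 mulrC.
- by rewrite !det_tridiagSS_first !det_tridiag1 !det_tridiag0 /=; ring.
rewrite (@det_tridiagSS_first R l.+2) (IH l.+1) //.
rewrite (IH l _ (fun i => d i.+2) (fun i => s i.+2)) //.
rewrite (@det_tridiagSS_first R l.+1 d s) (@det_tridiagSS_first R l d s) /=.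
ring.
Qed.

(** The recurrence reads B_(k+2) = x_(m+k+4) B_(k+1) - x_(m+k+3) B_k; its coefficients differ by 1,
    so the common value B_0 = B_1 = x_(m+1) propagates. *)
Lemma cloneB_shifted_plancherel (R : comNzRingType) (sigma : R) (k m : nat) :
  cloneB (shifted_plancherel sigma) (shifted_plancherel sigma) k m
    = shifted_plancherel sigma m.+1.
Proof.
rewrite /cloneB /shifted_plancherel.
elim/ltn_ind: k => -[|[|k]] IH.
- by rewrite det_tridiag1.
- by rewrite det_tridiagSS det_tridiag1 det_tridiag0 /=; ring.
rewrite det_tridiagSS (IH k.+1) // (IH k) //=; ring.
Qed.

(** Since x_(l+2) - 1 = x_(l+1) = y_(l+1), the recurrence becomes A_(l+2) - A_(l+1) = x_(l+1)
    (A_(l+1) - A_l), starting from A_1 - A_0 = sigma - 1. *)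
Lemma cloneA_shifted_plancherelS (R : comNzRingType) (sigma : R) (l : nat) :
  cloneA (shifted_plancherel sigma) (shifted_plancherel sigma) l.+1
  - cloneA (shifted_plancherel sigma) (shifted_plancherel sigma) l
    = (sigma - 1) * \prod_(1 <= i < l.+1) shifted_plancherel sigma i.
Proof.
elim: l => [|l IH].
  by rewrite /cloneA det_tridiag1 det_tridiag0 big_geq // /shifted_plancherel; ring.
rewrite big_nat_recr //= mulrA -IH /cloneA det_tridiagSS.
rewrite /shifted_plancherel -!natr1; ring.
Qed.

(** * Enumeration of the words of given weight *)

Definition letter_is2 (a : letter) : bool := if a is F2 then true else false.

Lemma letter_is2K : cancel letter_is2 (fun b : bool => if b then F2 else F1).
Proof. by case. Qed.

HB.instance Definition _ := Equality.copy letter (can_type letter_is2K).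

Fixpoint fibwords (n : nat) : seq (seq letter) :=
  match n with
  | 0 => [:: [::]]
  | m.+1 => [seq F1 :: w | w <- fibwords m] ++
      (if m is p.+1 then [seq F2 :: w | w <- fibwords p] else [::])
  end.

Lemma mem_fibwords (n : nat) (w : seq letter) :
  (w \in fibwords n) = (weight w == n).
Proof.
elim/ltn_ind: n w => -[|[|n]] IH w.
- by case: w => [|[]].
- case: w => [|[] [|[] w]] //.
rewrite [fibwords _]/= mem_cat.
case: w => [|[] w] /=.
- by apply/norP; split; apply/mapP => -[].
- rewrite mem_map => [|u v [] //].
  rewrite -/(fibwords n.+1) IH // [X in _ || X](_ : _ = false) ?orbF //.
  by apply/mapP => -[].
rewrite orbC mem_map => [|u v [] //].
rewrite IH // -[X in _ || X]/(_ \in [seq F1 :: w | w <- fibwords n.+1]).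
rewrite [X in _ || X](_ : _ = false) ?orbF //.
by apply/mapP => -[].
Qed.

Lemma fibwords_uniq (n : nat) : uniq (fibwords n).
Proof.
elim/ltn_ind: n => -[|[|n]] IH //.
rewrite [fibwords _]/= cat_uniq !map_inj_uniq; try by move=> u v [].
rewrite (IH n.+1) // IH //= andbT.
by apply/hasPn => u /mapP[v _ ->]; apply/mapP => -[].
Qed.

Lemma big_fibwordsSS (R : nmodType) (n : nat) (f : seq letter -> R) :
  \sum_(w <- fibwords n.+2) f w =
  \sum_(w <- fibwords n.+1) f (F1 :: w) + \sum_(w <- fibwords n) f (F2 :: w).
Proof. by rewrite [fibwords n.+2]/= big_cat /= !big_map. Qed.

(** * Weighted sums over words *)

Section ShiftedPlancherelSums.
Context {R : comNzRingType} (sigma : R).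
Let x := shifted_plancherel sigma.

(** At k = 0 this is the normalization of the measure. The induction needs all k, because a leading
    1 raises k by one while a leading 2 resets it to 0. *)
Lemma sum_dim_clone_schur_rec (k n : nat) :
  \sum_(w <- fibwords n) (yfdim w)%:R * clone_schur_rec x x k w =
  cloneA x x (k + n) - cloneA x x n + \prod_(1 <= i < n.+1) x i.
Proof.
elim/ltn_ind: n k => -[|[|n]] IH k.
- rewrite /= big_seq1 /= mul1r addn0 big_geq // {3}/cloneA det_tridiag0; ring.
- rewrite /= big_seq1 /= mul1r addn1 big_nat1 {3}/cloneA det_tridiag1; ring.
rewrite big_fibwordsSS [X in X + _](IH n.+1 _ k.+1) //=.
under [X in _ + X = _]eq_big_seq => w.
  rewrite mem_fibwords => /eqP ->.
  rewrite cloneB_shifted_plancherel natrM -/x mulrACA.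
  over.
rewrite -big_distrr /= IH //= add0n subrr add0r -mulrA (mulrC (x n.+1)).
rewrite -[_ * x n.+1](@big_nat_recr _ _ _ n.+1 1%N) //= addSnnS.
(* The two first letters contribute n+2 copies of the product up to n+1, and n+2 = x_(n+2) - (sigma
   - 1). *)
have := cloneA_shifted_plancherelS sigma n.+1; rewrite -/x.
rewrite (@big_nat_recr _ _ _ n.+2 1%N) //= => /eqP; rewrite subr_eq => /eqP ->.
rewrite /x /shifted_plancherel -!natr1; ring.
Qed.

(** The prefix 1^k influences only the factor of the first 2, which does not depend on k, or the
    all-ones word, which has no letter 2. *)
Lemma sum_count2_clone_schur_rec (k n : nat) :
  \sum_(w <- fibwords n)
     (yfdim w)%:R * clone_schur_rec x x k w * (count letter_is2 w)%:R =
  \sum_(w <- fibwords n)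
     (yfdim w)%:R * clone_schur x x w * (count letter_is2 w)%:R.
Proof.
rewrite /clone_schur.
suff H j : \sum_(w <- fibwords n)
     (yfdim w)%:R * clone_schur_rec x x j w * (count letter_is2 w)%:R =
   \sum_(w <- fibwords n)
     (yfdim w)%:R * clone_schur_rec x x j.+1 w * (count letter_is2 w)%:R.
  by elim: k => [//|k <-].
elim/ltn_ind: n j => -[|[|n]] IH j.
- by rewrite !big_seq1 /= !mulr0.
- by rewrite !big_seq1 /= !mulr0.
rewrite !big_fibwordsSS; congr (_ + _); first exact: (IH n.+1 _ j.+1).
by apply: eq_bigr => w _; rewrite /= !cloneB_shifted_plancherel.
Qed.

(** Here H n is the numerator of G_n. A leading 2 multiplies the weight by (n+1) x_(n+1) and adds
    one to the count; the added one yields the total mass, which is the product. *)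
Lemma sum_count2_clone_schurSS (n : nat) :
  let H n := \sum_(w <- fibwords n)
     (yfdim w)%:R * clone_schur x x w * (count letter_is2 w)%:R in
  H n.+2 = H n.+1 + n.+1%:R * (\prod_(1 <= i < n.+2) x i + x n.+1 * H n).
Proof.
move=> H; rewrite {1}/H big_fibwordsSS [X in X + _](sum_count2_clone_schur_rec 1).
congr (_ + _) => /=.
under eq_big_seq => w.
  rewrite mem_fibwords => /eqP wn.
  rewrite wn /clone_schur /= wn cloneB_shifted_plancherel -/x natrM natrD.
  rewrite (_ : _ * _ = n.+1%:R * (x n.+1 * ((yfdim w)%:R * clone_schur_rec x x 0 w)
     + x n.+1 * ((yfdim w)%:R * clone_schur_rec x x 0 w * (count letter_is2 w)%:R))); last by ring.
  over.
rewrite -big_distrr /= big_split /= -!big_distrr /= sum_dim_clone_schur_rec.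
rewrite add0n subrr add0r; congr (_ * (_ + _)).
by rewrite [RHS]big_nat_recr //= mulrC.
Qed.

End ShiftedPlancherelSums.

(** * Shapes of involutions *)

(* The shape of an involution [f] of [0, n): position [j] is skipped when its
   entry was already matched with the larger value [f j]. *)
Fixpoint descent_word (f : nat -> nat) (k : nat) : seq letter :=
  if k is j.+1 then
    if (j < f j)%N then descent_word f j
    else (if f j == j then F1 else F2) :: descent_word f j
  else [::].

(** Invariant: once the positions from k on are processed, the matched values are the larger points
    c >= k of two-cycles. *)
Lemma yfrs_rec_involution (n : nat) (f : nat -> nat)
    (f_lt : forall i, (i < n)%N -> (f i < n)%N)
    (fK : forall i, (i < n)%N -> f (f i) = i)
    (k : nat) (matched : seq nat) :
  (k <= n)%N ->
  (forall c, (c < n)%N -> (c \in matched) = (k <= c)%N && (f c < c)%N) ->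
  yfrs_rec matched [seq f i | i <- rev (iota 0 k)] = descent_word f k.
Proof.
elim: k matched => [//|k IH] matched kn matchedE.
have -> : iota 0 k.+1 = rcons (iota 0 k) k by rewrite -addn1 iotaD cats1.
rewrite rev_rcons /=.
rewrite matchedE ?f_lt // fK //.
have [fk|fk] := ltnP k (f k).
  rewrite /= IH ?(ltnW kn) // => c cn; rewrite matchedE //.
  by have [->|] := eqVneq c k; lia.
rewrite andbF.
(* The maximal unmatched entry is k: an entry f i > k with i <= k is already matched by the
   invariant, and k itself sits at position f k <= k. *)
rewrite (_ : bigop.body _ _ _ = k); last first.
  apply/eqP; rewrite eqn_leq; apply/andP; split.
    apply/bigmax_leqP_seq => c; rewrite inE => /orP[/eqP ->//|].
    case/mapP => i; rewrite mem_rev mem_iota add0n => /andP[_ ik] -> {c}.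
    have i_n : (i < n)%N by lia.
    by rewrite matchedE ?f_lt // fK //; lia.
  apply: leq_bigmax_seq => //; last by rewrite matchedE //; lia.
  have [-> | fkk] := eqVneq (f k) k; first by rewrite inE eqxx.
  rewrite inE; apply/orP; right; apply/mapP; exists (f k); last by rewrite fK.
  by rewrite mem_rev mem_iota; lia.
rewrite [k == _]eq_sym; have [fkk|fkk] := eqVneq (f k) k.
  rewrite /= IH ?(ltnW kn) // => c cn; rewrite matchedE //.
  by have [->|] := eqVneq c k; lia.
rewrite /= IH ?(ltnW kn) // => c cn; rewrite inE matchedE //.
by have [->|] := eqVneq c k; lia.
Qed.

Definition perm_nat (n : nat) (s : 'S_n) (i : nat) : nat :=
  if insub i is Some j then s j else i.

Lemma perm_natE (n : nat) (s : 'S_n) (i : 'I_n) : perm_nat s i = s i.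
Proof. by rewrite /perm_nat valK. Qed.

Lemma involutionP (n : nat) (s : 'S_n) :
  reflect (forall i, s (s i) = i) (involution s).
Proof.
apply: (iffP eqP) => [ss i|sK]; first by rewrite -permM ss perm1.
by apply/permP => i; rewrite permM perm1.
Qed.

Lemma yfrs_shape_involution (n : nat) (s : 'S_n) :
  involution s -> yfrs_shape s = descent_word (perm_nat s) n.
Proof.
move=> /involutionP sK; rewrite /yfrs_shape /oneline.
rewrite (_ : [seq _ | i <- _] = [seq perm_nat s i | i <- iota 0 n]).
  rewrite -map_rev; apply: (yfrs_rec_involution (n := n)) => // [i i_n|i i_n|c cn].
  - by rewrite -[i]/(val (Ordinal i_n)) perm_natE.
  - by rewrite -[i]/(val (Ordinal i_n)) !perm_natE sK.
  - by rewrite in_nil; lia.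
by rewrite -val_enum_ord -map_comp; apply: eq_map => i /=; rewrite perm_natE.
Qed.

Lemma count_descent_word (f : nat -> nat) (n : nat) :
  count letter_is2 (descent_word f n) = (\sum_(i < n) (f i < i)%N)%N.
Proof.
elim: n => [|n IH]; first by rewrite big_ord0.
rewrite big_ord_recr /= -IH; case: ltngtP => //= ?; lia.
Qed.

(** Every position gives one unit, except that i < f i gives none and f i < i gives two; the
    additive form avoids truncated subtraction. *)
Lemma weight_descent_word (f : nat -> nat) (n : nat) :
  (weight (descent_word f n) + \sum_(i < n) (i < f i)%N =
   n + \sum_(i < n) (f i < i)%N)%N.
Proof.
elim: n => [|n IH]; first by rewrite !big_ord0.
rewrite !big_ord_recr /=; case: ltngtP => _ /=.
- by rewrite addnA IH addn0 addn1 addSn.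
- by rewrite addn0 !addSn IH addn1 addnS.
- by rewrite !addn0 !addSn IH.
Qed.

Lemma weight_yfrs_shape (n : nat) (s : 'S_n) :
  involution s -> weight (yfrs_shape s) = n.
Proof.
move=> s_inv; rewrite yfrs_shape_involution //.
have sK := elimT (involutionP _) s_inv.
have := weight_descent_word (perm_nat s) n.
under eq_bigr do rewrite perm_natE.
under [in X in _ = X -> _]eq_bigr do rewrite perm_natE.
(* Reindexing by [s] exchanges the positions with i < s i and those with s i < i, so both counts
   cancel. *)
rewrite (reindex_inj (@perm_inj _ s)) /=.
under eq_bigr do rewrite sK.
by move/addIn.
Qed.

Lemma porbit_involution (n : nat) (s : 'S_n) (i : 'I_n) :
  involution s -> porbit s i = [set i; s i]%SET.
Proof.
move=> /eqP ss; apply/setP => j; rewrite !inE; apply/porbitP/orP.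
  move=> [m ->]; rewrite -[m]odd_double_half -muln2 mulnC expgD expgM expg2 ss expg1n.
  by rewrite mulg1; case: odd; rewrite ?expg1 ?expg0 ?perm1 eqxx; [right|left].
by case=> /eqP ->; [exists 0%N; rewrite expg0 perm1|exists 1%N; rewrite expg1].
Qed.

(** Each two-cycle is the orbit of a unique point i with s i < i, its larger one, and these points
    are what the letters 2 count. *)
Lemma two_cycles_involution (n : nat) (s : 'S_n) :
  involution s -> two_cycles s = count letter_is2 (yfrs_shape s).
Proof.
move=> s_inv; have sK := elimT (involutionP _) s_inv.
rewrite yfrs_shape_involution // count_descent_word.
under eq_bigr do rewrite perm_natE.
rewrite -big_mkcond /= sum1_card.
rewrite -(@card_in_imset _ _ (porbit s)).
  apply: eq_card => c; rewrite inE; apply/andP/imsetP.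
    move=> [/imsetP[i _ ->]]; rewrite porbit_involution // cards2.
    case: (ltngtP (val i) (s i)) => // [ii _|ii _|ii].
    - by exists (s i); rewrite ?porbit_involution ?unfold_in /= ?sK // finset.setUC.
    - by exists i; rewrite ?porbit_involution.
    - by rewrite -(val_inj ii) eqxx.
  move=> [i ii ->]; split; first exact: imset_f.
  rewrite porbit_involution // cards2; case: (eqVneq i (s i)) => // ie.
  by have := ii : (s i < i)%N; rewrite -ie ltnn.
move=> i j; rewrite !unfold_in => ii jj.
rewrite !porbit_involution // => /setP e.
have := e i; rewrite !inE eqxx /= => /esym/orP[/eqP//|/eqP ij].
by move: ii; rewrite ij sK; lia.
Qed.

(** * Every word is a shape *)

(* An involution of shape [w]. *)
Fixpoint adjacent_swaps (w : seq letter) (i : nat) : nat :=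
  match w with
  | [::] => i
  | F1 :: v => adjacent_swaps v i
  | F2 :: v => if i == weight v then (weight v).+1
               else if i == (weight v).+1 then weight v
               else adjacent_swaps v i
  end.

Lemma adjacent_swaps_ge (w : seq letter) (i : nat) :
  (weight w <= i)%N -> adjacent_swaps w i = i.
Proof.
elim: w => [//|[] w IH] /= wi; first by rewrite IH; lia.
by rewrite IH; last lia; do 2 (case: ifP; try lia).
Qed.

Lemma adjacent_swaps_lt (w : seq letter) (i : nat) :
  (i < weight w)%N -> (adjacent_swaps w i < weight w)%N.
Proof.
elim: w => [//|[] w IH] /= wi.
  have [/IH|/adjacent_swaps_ge->] := ltnP i (weight w); lia.
have [/IH|/adjacent_swaps_ge->] := ltnP i (weight w); do 2 (case: ifP; try lia).
Qed.

Lemma adjacent_swapsK (w : seq letter) : involutive (adjacent_swaps w).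
Proof.
elim: w => [//|[] w IH] i //=.
have [->|iw] := eqVneq i (weight w); first by rewrite eqxx; case: eqP; lia.
have [->|iw'] := eqVneq i (weight w).+1; first by rewrite eqxx.
have [iw2|iw2] := ltnP i (weight w).
  by have := adjacent_swaps_lt iw2; do 2 (case: eqP; first lia).
rewrite adjacent_swaps_ge // (negPf iw) (negPf iw') adjacent_swaps_ge //.
Qed.

Lemma eq_descent_word (f g : nat -> nat) (n : nat) :
  (forall i, (i < n)%N -> f i = g i) -> descent_word f n = descent_word g n.
Proof.
elim: n => [//|n IH] fg /=; rewrite fg // IH // => i i_n.
by apply: fg; lia.
Qed.

Lemma descent_word_adjacent_swaps (w : seq letter) :
  descent_word (adjacent_swaps w) (weight w) = w.
Proof.
elim: w => [//|[] w IH].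
  by rewrite /= adjacent_swaps_ge // ltnn eqxx IH.
rewrite [weight _]/=; set g := adjacent_swaps _; set m := weight w.
have g1 : g m.+1 = m by rewrite /g /= -/m (gtn_eqF (ltnSn m)) eqxx.
have g2 : g m = m.+1 by rewrite /g /= eqxx.
rewrite /= g1 g2 ltnSn ltnNge leqnSn /= (ltn_eqF (ltnSn m)); congr cons.
rewrite -[RHS]IH; apply: eq_descent_word => i im.
by rewrite /g /= -/m (ltn_eqF im) (ltn_eqF (ltnW im : (i < m.+1)%N)).
Qed.

Lemma yfrs_shape_surj (w : seq letter) :
  exists2 s : 'S_(weight w), involution s & yfrs_shape s = w.
Proof.
pose f (i : 'I_(weight w)) : 'I_(weight w) :=
  Ordinal (adjacent_swaps_lt (ltn_ord i)).
have fK : involutive f by move=> i; apply: val_inj; exact: adjacent_swapsK.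
pose s := perm (can_inj fK).
have s_inv : involution s by apply/involutionP => i; rewrite !permE fK.
exists s => //; rewrite yfrs_shape_involution // -[RHS]descent_word_adjacent_swaps.
apply: eq_descent_word => i i_w.
by rewrite -[i]/(val (Ordinal i_w)) perm_natE permE.
Qed.

(** * The expectation as a sum over words *)

Lemma expected_two_cyclesE (R : numFieldType) (sigma : R) (n : nat) :
  let x := shifted_plancherel sigma in
  expected_two_cycles sigma n =
  (\sum_(w <- fibwords n)
     (yfdim w)%:R * clone_schur x x w * (count letter_is2 w)%:R)
  / \prod_(1 <= i < n.+1) x i.
Proof.
move=> x; rewrite /expected_two_cycles -/x.
pose C (w : seq letter) := [set t : 'S_n | involution t & yfrs_shape t == w]%SET.
pose F (w : seq letter) := (yfdim w)%:R * clone_harmonic x x w * (count letter_is2 w)%:R / #|C w|%:R.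
transitivity (\sum_(s : 'S_n) \sum_(w <- fibwords n | s \in C w) F w).
  apply: eq_bigr => s _; rewrite /nu.
  case: ifP => s_inv; last by rewrite mul0r big1 // => w; rewrite inE s_inv.
  rewrite (eq_bigl (fun w => w == yfrs_shape s)); last first.
    by move=> w; rewrite inE s_inv eq_sym.
  rewrite -big_filter filter_pred1_uniq ?fibwords_uniq ?mem_fibwords ?weight_yfrs_shape //.
  rewrite big_seq1 /F two_cycles_involution // mulrAC; congr (_ / _%:R).
  apply: eq_card => t; rewrite !inE; congr (_ && _).
  by apply/asboolP/eqP.
rewrite (exchange_big_dep predT) //= mulr_suml.
apply: eq_big_seq => w; rewrite mem_fibwords => /eqP wn.
(* The size of the class of [w] cancels the uniform choice inside it; it is nonzero because every
   word is a shape. *)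
rewrite sumr_const -[F w *+ _]mulr_natr /F divfK; last first.
  rewrite pnatr_eq0 -lt0n; apply/card_gt0P.
  by case: (yfrs_shape_surj w); rewrite wn => s s_inv sw; exists s; rewrite inE s_inv sw eqxx.
by rewrite /clone_harmonic wn mulrA mulrAC.
Qed.

(** * Recurrence, error bound and limit *)

Lemma prod_shifted_plancherel_neq0 (R : realFieldType) (sigma : R) (n : nat) :
  1 <= sigma ->
  \prod_(1 <= i < n.+1) shifted_plancherel sigma i != 0.
Proof.
move=> sigma_ge1; rewrite gt_eqF // big_nat_cond; apply: prodr_gt0 => -[|i] // _.
by rewrite /shifted_plancherel -natr1; have := ler0n R i; lra.
Qed.

Lemma expected_two_cycles01 (R : numFieldType) (sigma : R) :
  expected_two_cycles sigma 0 = 0 /\ expected_two_cycles sigma 1 = 0.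
Proof. by rewrite !expected_two_cyclesE !big_seq1 /= !mulr0 !mul0r. Qed.

Lemma expected_two_cyclesSS (R : realFieldType) (sigma : R) (n : nat) :
  let G := expected_two_cycles sigma in
  1 <= sigma -> G n.+2 * (n.+1%:R + sigma) = G n.+1 + n.+1%:R * (1 + G n).
Proof.
move=> G sigma_ge1; rewrite /G !expected_two_cyclesE sum_count2_clone_schurSS.
have := prod_shifted_plancherel_neq0 n.+2 sigma_ge1.
rewrite !(@big_nat_recr _ _ _ n.+2 1%N) ?(@big_nat_recr _ _ _ n.+1 1%N) //=.
set P := bigop.body _ _ _; set H := bigop.body _ _ _; set H1 := bigop.body _ _ _.
rewrite !mulf_eq0 !negb_or => /andP[/andP[P0 x1] x2].
have xE : shifted_plancherel sigma n.+2 = n.+1%:R + sigma.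
  by rewrite /shifted_plancherel -[n.+2%:R]natr1; ring.
move: x2; rewrite xE; move: n.+1%:R => N x2; field.
by rewrite P0 x1 x2.
Qed.

Lemma expected_two_cycles_error (R : realFieldType) (sigma : R) (n : nat) :
  1 <= sigma ->
  `|expected_two_cycles sigma n - n%:R / (sigma + 1)| <= series harmonic n.
Proof.
move=> sigma_ge1; set G := expected_two_cycles sigma.
have s1 : 0 < sigma + 1 by lra.
have [G0 G1] : G 0 = 0 /\ G 1 = 0 := expected_two_cycles01 sigma.
set c := (sigma + 1)^-1.
have c0 : 0 < c by rewrite invr_gt0.
have c1 : c <= 1 by rewrite invf_le1 //; lra.
have cE : c * (sigma + 1) = 1 by rewrite mulVf // gt_eqF.
elim/ltn_ind: n => -[|[|n]] IH.
- by rewrite G0 mul0r subrr normr0 /series /= big_geq.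
- rewrite G1 sub0r normrN mul1r gtr0_norm // /series /= big_nat1 invr1 //.
set e2 := G n.+2 - _.
have IH1 := IH _ (ltnSn n.+1); have IH0 := IH n (ltnW (ltnSn n.+1)).
have hS m : series harmonic m.+1 = series harmonic m + m.+1%:R^-1 :> R.
  by rewrite /series /= big_nat_recr.
rewrite !hS in IH1 *.
set h := series harmonic n in IH0 IH1 *; set h2 := _ + n.+2%:R^-1.
have n0 : 0 < n.+2%:R :> R by rewrite ltr0n.
have n1 : 0 < n.+1%:R :> R by rewrite ltr0n.
have nE : n.+2%:R = n.+1%:R + 1 :> R by rewrite natr1.
(* Inserting the line n c into the recurrence leaves the residue c - 1, of absolute value at most
   1. *)
have key : e2 * (n.+1%:R + sigma) =
    (G n.+1 - n.+1%:R * c) + n.+1%:R * (G n - n%:R * c) + (c - 1).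
  have cs : c * sigma = 1 - c by lra.
  have Ncs : n.+1%:R * (c * sigma) = n.+1%:R * (1 - c) by rewrite cs.
  rewrite /e2 mulrBl /G expected_two_cyclesSS // -/G nE.
  by move: Ncs cs; rewrite -[n.+1%:R]natr1; lra.
(* With N = n+1 the induction hypotheses bound the left side by (N+1) h + 1/N + 1, while the right
   side is (N+1) h + 1/N + 2. *)
have : `|e2| * (n.+1%:R + sigma) <= n.+2%:R * h2.
  rewrite -[X in _ * X](@ger0_norm _ (n.+1%:R + sigma)); last by lra.
  rewrite -normrM key.
  apply: (le_trans (ler_normD _ _)).
  apply: (le_trans (lerD (ler_normD _ _) (lexx _))).
  rewrite normrM (@ger0_norm _ n.+1%:R) ?(ltW n1) //.
  have : `|c - 1| <= 1 by rewrite ler_norml; lra.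
  have : n.+1%:R * `|G n - n%:R * c| <= n.+1%:R * h by rewrite ler_pM2l.
  have : n.+2%:R * h2 = n.+2%:R * h + n.+2%:R / n.+1%:R + 1.
    by rewrite /h2; field; rewrite !gt_eqF.
  have : n.+2%:R / n.+1%:R = 1 + n.+1%:R^-1 :> R.
    by rewrite nE; field; rewrite gt_eqF.
  have : 0 < n.+1%:R^-1 :> R by rewrite invr_gt0.
  move: IH1; rewrite nE; clearbody h h2; move: n.+1%:R n.+1%:R^-1 => N NV; lra.
(* This is where sigma >= 1 enters: n+2 <= n+1+sigma. *)
have : n.+2%:R * `|e2| <= `|e2| * (n.+1%:R + sigma).
  by rewrite mulrC ler_wpM2l // nE; lra.
by move=> /le_trans/[apply]; rewrite ler_pM2l.
Qed.

Theorem proposition17p5 (R : realType) (sigma : R) (hsigma : 1 <= sigma) :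
  expected_two_cycles sigma n / n%:R @[n --> \oo] --> 1 / (sigma + 1).
Proof.
rewrite -cvg_shiftS /=; apply/cvgrPdist_le => eps eps0.
(* The Cesàro means of 1/(n+1), which tends to 0, are the harmonic numbers divided by their index;
   after the shift they match the error bound at n+1 divided by n+1. *)
have := cesaro (@cvg_harmonic R) => /cvgrPdist_le /(_ _ eps0).
apply: filterS => n; rewrite sub0r normrN => mean_le.
apply: le_trans mean_le; rewrite distrC.
have n1 : 0 < n.+1%:R :> R by rewrite ltr0n.
have -> : expected_two_cycles sigma n.+1 / n.+1%:R - 1 / (sigma + 1) =
    n.+1%:R^-1 * (expected_two_cycles sigma n.+1 - n.+1%:R / (sigma + 1)).
  by field; rewrite !gt_eqF //; lra.
rewrite normrM /arithmetic_mean /= normrM ler_pM2l ?normr_gt0 ?invr_neq0 ?gt_eqF //.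
exact: le_trans (expected_two_cycles_error _ hsigma) (ler_norm _).
Qed.
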